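(* Let $\lambda$ be a staircase partition with $\ell(\lambda)\ge 3$. Then the chromatic number of the graph $B_\lambda$ is $\chi(B_\lambda)=2$.
   Context: A staircase partition is a partition of the form $\lambda=(\ell,\ell-1,\dots,2,1)$; $\ell(\lambda)=\ell$ is its number of parts. For $\ell\ge 3$ put $r=\ell+1$ and let $\sigma\in\mathfrak{S}_r$ be the permutation with one-line notation $2,3,\dots,r-3,r,r-2,r-1,1$ (for $r=4$ this is $4231$). The graph $\mathcal{G}_\sigma$ has as vertices the reduced words of $\sigma$, two reduced words being joined by an edge if they differ by a single braid relation or a single commutation relation. $B_\lambda$ is the graph $\mathcal{G}_\sigma$ viewed through the identification of its vertices with the boxes of the Ferrers diagram of $\lambda$, two vertices being adjacent if and only if the corresponding boxes share a side. Concretely, $B_\lambda$ is the simple graph with vertex set $\{(a,b)\in\mathbb{Z}_{\ge0}^2: a+b\le \ell-1\}$ in which $(a,b)$ and $(a',b')$ are adjacent iff $|a-a'|+|b-b'|=1$. *)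

(* Defs.v *)
From mathcomp Require Import all_boot all_order all_algebra.

Set Implicit Arguments.
Unset Strict Implicit.
Unset Printing Implicit Defensive.

Record sgraph := SGraph {
  svertex :> finType;
  sedge : rel svertex;
  sedge_sym : symmetric sedge;
  sedge_irrefl : irreflexive sedge }.

Definition proper_coloring (G : sgraph) (k : nat) (f : {ffun G -> 'I_k}) : bool :=
  [forall x : G, forall y : G, sedge x y ==> (f x != f y)].

Definition colorable (G : sgraph) (k : nat) : bool :=
  [exists f : {ffun G -> 'I_k}, proper_coloring f].

Lemma colorable_ex (G : sgraph) : exists k, colorable G k.
Proof.
exists #|G|; apply/existsP; exists [ffun x => enum_rank x].
apply/forallP=> x; apply/forallP=> y; apply/implyP=> exy; rewrite !ffunE.
by apply: contraTneq exy => /enum_rank_inj ->; rewrite sedge_irrefl.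
Qed.

Definition chromatic_number (G : sgraph) : nat := ex_minn (colorable_ex G).

(* Partitions are the sequences of their parts, largest part first. *)
Definition is_staircase (la : seq nat) : bool := la == rev (iota 1 (size la)).

(* The box existT a b lies in row a and column b, both counted from 0. *)
Definition box (la : seq nat) : finType := {a : 'I_(size la) & 'I_(nth 0 la a)}.

Definition box_row (la : seq nat) (x : box la) : nat := tag x.
Definition box_col (la : seq nat) (x : box la) : nat := tagged x.

Definition share_side (la : seq nat) : rel (box la) :=
  fun x y => `|box_row x - box_row y|%N + `|box_col x - box_col y|%N == 1.

Lemma share_side_sym (la : seq nat) : symmetric (@share_side la).
Proof. by move=> x y; rewrite /share_side ![`|box_row x - _|%N]distnC ![`|box_col x - _|%N]distnC. Qed.

Lemma share_side_irrefl (la : seq nat) : irreflexive (@share_side la).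
Proof. by move=> x; rewrite /share_side !distnn. Qed.

Definition B (la : seq nat) : sgraph :=
  SGraph (@share_side_sym la) (@share_side_irrefl la).

Lemma nth_staircase (la : seq nat) (a : nat) :
  is_staircase la -> nth 0 la a = size la - a.
Proof.
move=> /eqP E; have [alt|lea] := ltnP a (size la); last first.
  by rewrite nth_default // (eqP (_ : size la - a == 0)) // subn_eq0.
rewrite {1}E nth_rev ?size_iota // nth_iota; last by rewrite ltn_subrL (leq_ltn_trans _ alt).
by rewrite add1n subnSK.
Qed.

Lemma staircase_boxP (la : seq nat) (a b : nat) : is_staircase la -> 0 < size la ->
  (exists x : box la, box_row x = a /\ box_col x = b) <-> a + b <= (size la).-1.
Proof.
move=> st l0; rewrite -ltnS prednK //; split.
  case=> -[i j] [<- <-]; rewrite /box_row /box_col /=.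
  by have := ltn_ord j; rewrite {2}(nth_staircase _ st) ltn_subRL.
move=> ab; have alt : a < size la by apply: leq_ltn_trans ab; apply: leq_addr.
have blt : b < nth 0 la (Ordinal alt) by rewrite (nth_staircase _ st) ltn_subRL.
by exists (existT (fun i : 'I_(size la) => 'I_(nth 0 la i)) (Ordinal alt) (Ordinal blt)).
Qed.

(* Main.v *)
(* Colouring the box in row a and column b by the parity of a + b is proper,
   since crossing a side changes exactly one coordinate by one; and the boxes
   (0, 0) and (0, 1) are adjacent, so one colour does not suffice. *)
Require Import Defs.
From mathcomp Require Import all_boot all_order all_algebra.
From mathcomp Require Import zify.

(** Lets a colouring be given by a boolean such as a parity; [inord] sends false and true to the
    colours 0 and 1 of ['I_2]. *)
Lemma colorable2 (G : sgraph) (c : G -> bool) :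
  (forall x y : G, sedge x y -> c x != c y) -> colorable G 2.
Proof.
move=> c_proper; apply/existsP; exists [ffun x => inord (c x)].
apply/forallP=> x; apply/forallP=> y; apply/implyP=> /c_proper; rewrite !ffunE.
by case: (c x) (c y) => [] [] // _; rewrite -val_eqE /= !inordK.
Qed.

(** The ends of the edge receive two distinct naturals below [k]. *)
Lemma edge_colorable_gt1 (G : sgraph) (x y : G) (k : nat) :
  sedge x y -> colorable G k -> 1 < k.
Proof.
move=> exy /existsP[f /forallP/(_ x)/forallP/(_ y)]; rewrite exy /=.
by case: (f x) (f y) => [i ltik] [j ltjk]; rewrite -val_eqE /=; lia.
Qed.

Lemma chromatic_number2 (G : sgraph) (x y : G) :
  sedge x y -> colorable G 2 -> chromatic_number G = 2.
Proof.
rewrite /chromatic_number => exy col2; case: ex_minnP => m colm minm.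
(* Minimality and [col2] give [m <= 2]; the edge gives [1 < m]. *)
by apply/eqP; rewrite eqn_leq minm // (edge_colorable_gt1 _ _ _ _ exy).
Qed.

Lemma share_side_parity (la : seq nat) (x y : box la) :
  share_side x y ->
  odd (box_row x + box_col x) != odd (box_row y + box_col y).
Proof.
rewrite /share_side; move: (box_row x) (box_col x) (box_row y) (box_col y).
lia.
Qed.

Theorem corollary3p3 (la : seq nat) (stair_la : is_staircase la)
    (len_la : 3 <= size la) :
  chromatic_number (B la) = 2.
Proof.
have la_gt0 : 0 < size la by lia.
(* Both boxes lie in the diagram since 0 + 1 is at most [(size la).-1]. *)
have [|x [x_row x_col]] := (staircase_boxP 0 0 stair_la la_gt0).2; first lia.
have [|y [y_row y_col]] := (staircase_boxP 0 1 stair_la la_gt0).2; first lia.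
apply: (chromatic_number2 (B la) x y).
  by rewrite /= /share_side x_row x_col y_row y_col.
exact: (colorable2 (B la) _ (@share_side_parity la)).
Qed.
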